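(* Let $\varepsilon>0$ and let the Levenberg-Marquardt approximation $B_\ell^k=(J_\ell^k)^\top J_\ell^k+\varepsilon I$ be used for all $\ell\in\mathcal R$, so that the condensed quadratic program $$\min_{x,z}\ \sum_{\ell\in\mathcal R}\Big\{\tfrac12 x_\ell^\top \overline B_\ell^k x_\ell+\big(\overline g_\ell^k-\overline B_\ell^k x_\ell^k\big)^\top x_\ell\Big\}\quad\text{subject to}\quad x_\ell=E_\ell z\ \ (\text{multiplier }\lambda_\ell),\ \ \ell\in\mathcal R,\qquad (\mathrm{QP}_k)$$ is strongly convex. Given an iterate $\chi^k$, let $\bar z$, $\lambda_\ell^{k+1}$ and $\chi_\ell^{k+1}$ be produced by one iteration of the HDSQP algorithm (given in the context). Then the triple $$\big(x_\ell^{k+1}:=A_\ell\chi_\ell^{k+1},\quad z^{k+1}:=\bar z,\quad \lambda_\ell^{k+1}\big)_{\ell\in\mathcal R}$$ solves $(\mathrm{QP}_k)$; that is, it is a primal-dual solution, with $(x^{k+1},z^{k+1})$ a global minimizer and $\lambda^{k+1}$ a corresponding Lagrange multiplier for the constraints $x_\ell=E_\ell z$.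
   Context: Setting. $\mathcal R$ is a finite set of regions. For each $\ell\in\mathcal R$ the real state vector is $\chi_\ell=(x_\ell,y_\ell)$, where $x_\ell$ are the coupling variables and $y_\ell$ are hidden variables entirely local to region $\ell$. $A_\ell$ is the matrix with $A_\ell\chi_\ell=x_\ell$, i.e. $A_\ell=[I\ \ 0]$. The vector $z$ collects the common values of the coupling variables of all regions (one entry per shared quantity), and $E_\ell$ is the incidence matrix of region $\ell$: a 0-1 matrix, each row of which has exactly one entry equal to $1$, so that $x_\ell=E_\ell z$ says every coupling variable of region $\ell$ equals its common value. Each entry of $z$ is the common value of at least one coupling variable, so the stacked matrix $E$ (the $E_\ell$, $\ell\in\mathcal R$, stacked vertically) has full column rank. Stacked vectors are written $x=(x_\ell)_{\ell\in\mathcal R}$, etc. The problem being solved is $\min_{\chi,z}\sum_{\ell\in\mathcal R} f_\ell(\chi_\ell)$ subject to $A_\ell\chi_\ell=E_\ell z$, $\ell\in\mathcal R$, where $f_\ell(\chi_\ell)=\frac12\|r_\ell(\chi_\ell)\|_2^2$ and $r_\ell$ is a smooth vector-valued residual function (the residuals of the AC power flow equations in region $\ell$). At iterate $\chi^k$, write $r_\ell^k=r_\ell(\chi_\ell^k)$ and let $J_\ell^k$ be the Jacobian of $r_\ell$ at $\chi_\ell^k$. Set $x_\ell^k=A_\ell\chi_\ell^k$. One iteration of the HDSQP algorithm from $\chi^k$: 1. For all $\ell\in\mathcal R$ compute $B_\ell^k=(J_\ell^k)^\top J_\ell^k+\varepsilon I$ and $g_\ell^k=(J_\ell^k)^\top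 r_\ell^k$. Partition with respect to $(x_\ell,y_\ell)$: $$B_\ell^k=\begin{bmatrix}B_\ell^{xx}&B_\ell^{xy}\\ B_\ell^{yx}&B_\ell^{yy}\end{bmatrix},\qquad g_\ell^k=\begin{bmatrix}g_\ell^x\\ g_\ell^y\end{bmatrix},$$ and compute the condensed quantities (Schur complements) $$\overline g_\ell^k=g_\ell^x-B_\ell^{xy}(B_\ell^{yy})^{-1}g_\ell^y,\qquad \overline B_\ell^k=B_\ell^{xx}-B_\ell^{xy}(B_\ell^{yy})^{-1}B_\ell^{yx}.$$ 2. For all $\ell\in\mathcal R$ compute $\bar x_\ell=(\overline B_\ell^k)^{-1}\big(\overline B_\ell^k x_\ell^k-\overline g_\ell^k\big)$. 3. Compute the weighted average $\displaystyle \bar z=\Big(\sum_{\ell\in\mathcal R}E_\ell^\top\overline B_\ell^kE_\ell\Big)^{-1}\sum_{\ell\in\mathcal R}E_\ell^\top\overline B_\ell^k\bar x_\ell.$ 4. For all $\ell\in\mathcal R$ update $$\lambda_\ell^{k+1}=\overline B_\ell^k(\bar x_\ell-E_\ell\bar z),\qquad \chi_\ell^{k+1}=(B_\ell^k)^{-1}\big(B_\ell^k\chi_\ell^k-g_\ell^k-A_\ell^\top\lambda_\ell^{k+1}\big).$$ Convention for multipliers: the Lagrangian of the condensed quadratic program is $\sum_{\ell}\{\frac12 x_\ell^\top\overline B_\ell^kx_\ell+(\overline g_\ell^k-\overline B_\ell^kx_\ell^k)^\top x_\ell+\lambda_\ell^\top x_\ell\}-\lambda^\top Ez$, and its KKT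 conditions are $\overline B_\ell^k(x_\ell-x_\ell^k)+\overline g_\ell^k+\lambda_\ell=0$ and $x_\ell=E_\ell z$ for all $\ell\in\mathcal R$, together with $\sum_{\ell}E_\ell^\top\lambda_\ell=0$. *)

(* Defs.v *)
(* All vectors are column vectors; the stacked
   vector (x_l)_l is the dependent family x : forall l, 'cV_(nx l). *)
From HB Require Import structures.
From mathcomp Require Export all_boot all_order all_algebra.
From mathcomp Require Export all_classical all_reals.
From mathcomp Require Export topology normedtype derive.

Set Implicit Arguments.
Unset Strict Implicit.
Unset Printing Implicit Defensive.

Import Order.TTheory GRing.Theory Num.Theory.
Import numFieldNormedType.Exports.

Local Open Scope ring_scope.

Definition dotv (R : realType) n (u v : 'cV[R]_n) : R := (u^T *m v) 0 0.

(* A map is C^(k+1) iff it is differentiable and all its directional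
   derivatives are C^k. *)
Fixpoint isC (R : realType) (V W : normedModType R) (k : nat) (f : V -> W)
    : Prop :=
  if k is j.+1 then
    (forall a, differentiable f a) /\ (forall v, isC j (fun a => 'D_v f a))
  else continuous f.

Definition smooth (R : realType) (V W : normedModType R) (f : V -> W) : Prop :=
  forall k, isC k f.

(* The library's jacobian is for maps between row vectors and acts by right
   multiplication (Df(a) h = h *m 'J f a); the usual q x n Jacobian of a map of
   column vectors is obtained by transposing. *)
Definition colJacobian (R : realType) n q (r : 'cV[R]_n -> 'cV[R]_q)
    (a : 'cV[R]_n) : 'M[R]_(q, n) :=
  (jacobian (fun v : 'rV[R]_n => (r v^T)^T) a^T)^T.

Section Incidence.
Variables (R : realType) (Reg : finType) (nx : Reg -> nat) (p : nat).

(* The last clause says that every entry of z is the common value of some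
   coupling variable; given the first two, it amounts to the full column rank
   of the stacked matrix. *)
Definition incidence (E : forall l, 'M[R]_(nx l, p)) : Prop :=
  [/\ forall l i j, E l i j = 0 \/ E l i j = 1,
      forall l i, exists! j, E l i j = 1
    & forall j, exists l, exists i, E l i j = 1].

End Incidence.

Section Condensation.
Variables (R : realType) (n m : nat).

Definition selx : 'M[R]_(n, n + m) := row_mx 1%:M 0.

Definition condB (B : 'M[R]_(n + m)) : 'M[R]_n :=
  ulsubmx B - ursubmx B *m invmx (drsubmx B) *m dlsubmx B.

Definition condg (B : 'M[R]_(n + m)) (g : 'cV[R]_(n + m)) : 'cV[R]_n :=
  usubmx g - ursubmx B *m invmx (drsubmx B) *m dsubmx g.

End Condensation.

Section QuadraticProgram.
Variables (R : realType) (Reg : finType) (nx : Reg -> nat) (p : nat).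
Variable E : forall l, 'M[R]_(nx l, p).
Variables (Bb : forall l, 'M[R]_(nx l)) (gb xk : forall l, 'cV[R]_(nx l)).

Definition qp_obj (x : forall l, 'cV[R]_(nx l)) : R :=
  \sum_l (2^-1 * dotv (x l) (Bb l *m x l)
          + dotv (gb l - Bb l *m xk l) (x l)).

Definition qp_feasible (x : forall l, 'cV[R]_(nx l)) (z : 'cV[R]_p) : Prop :=
  forall l, x l = E l *m z.

Definition qp_minimizer (x : forall l, 'cV[R]_(nx l)) (z : 'cV[R]_p) : Prop :=
  qp_feasible x z /\
  forall x' z', qp_feasible x' z' -> qp_obj x <= qp_obj x'.

(* KKT system of the Lagrangian qp_obj x + \sum_l lam_l^T (x_l - E_l z). *)
Definition qp_kkt (x : forall l, 'cV[R]_(nx l)) (z : 'cV[R]_p)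
    (lam : forall l, 'cV[R]_(nx l)) : Prop :=
  [/\ forall l, Bb l *m (x l - xk l) + gb l + lam l = 0,
      qp_feasible x z
    & \sum_l (E l)^T *m lam l = 0].

(* The objective does not involve z: strong convexity is in x, with respect to
   the Euclidean norm of the stacked vector. *)
Definition qp_strongly_convex : Prop :=
  exists2 mu : R, 0 < mu &
    forall (x x' : forall l, 'cV[R]_(nx l)) (t : R), 0 <= t <= 1 ->
      qp_obj (fun l => t *: x l + (1 - t) *: x' l)
        <= t * qp_obj x + (1 - t) * qp_obj x'
           - mu / 2 * t * (1 - t) * \sum_l dotv (x l - x' l) (x l - x' l).

End QuadraticProgram.

Section HDSQP.
Variables (R : realType) (Reg : finType) (nx ny nr : Reg -> nat) (p : nat).
Variable E : forall l, 'M[R]_(nx l, p).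
Variable r : forall l, 'cV[R]_(nx l + ny l) -> 'cV[R]_(nr l).
Variable eps : R.
Variable chi : forall l, 'cV[R]_(nx l + ny l).

Definition Jk l : 'M[R]_(nr l, nx l + ny l) := colJacobian (@r l) (chi l).

Definition Bk l : 'M[R]_(nx l + ny l) := (Jk l)^T *m Jk l + eps%:M.

Definition gk l : 'cV[R]_(nx l + ny l) := (Jk l)^T *m r (chi l).

Definition Bbark l : 'M[R]_(nx l) := condB (Bk l).

Definition gbark l : 'cV[R]_(nx l) := condg (Bk l) (gk l).

Definition xk l : 'cV[R]_(nx l) := selx R (nx l) (ny l) *m chi l.

Definition xbar l : 'cV[R]_(nx l) :=
  invmx (Bbark l) *m (Bbark l *m xk l - gbark l).

Definition coordM : 'M[R]_p := \sum_l (E l)^T *m Bbark l *m E l.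

Definition zbar : 'cV[R]_p :=
  invmx coordM *m \sum_l (E l)^T *m Bbark l *m xbar l.

Definition lam_next l : 'cV[R]_(nx l) := Bbark l *m (xbar l - E l *m zbar).

Definition chi_next l : 'cV[R]_(nx l + ny l) :=
  invmx (Bk l) *m
    (Bk l *m chi l - gk l - (selx R (nx l) (ny l))^T *m lam_next l).

Definition x_next l : 'cV[R]_(nx l) := selx R (nx l) (ny l) *m chi_next l.

(* invmx is total (invmx A = A for singular A), so that the inverses taken
   above are genuine has to be said separately. *)
Definition hdsqp_well_defined : Prop :=
  (forall l, [/\ drsubmx (Bk l) \in unitmx, Bbark l \in unitmx
               & Bk l \in unitmx])
  /\ coordM \in unitmx.

End HDSQP.

(* Main.v *)
(* Each B_l is symmetric with B_l >= eps I. Both properties pass to the Schur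
   complement: for y = - (B^yy)^-1 B^yx x one has B (x, y) = (condB B x, 0), so
   the condensed quadratic form at x is the full one at (x, y). Eliminating the
   hidden variables from the update of chi likewise gives
   Bbar x_next = Bbar x_k - gbar - lam_next, which is the stationarity condition;
   as Bbar xbar = Bbar x_k - gbar, it also gives Bbar x_next = Bbar (E zbar),
   that is primal feasibility. Dual feasibility is the definition of zbar, and by
   convexity a KKT point is a global minimizer. *)
Require Import Defs.
From mathcomp Require Import lra.

Set Implicit Arguments.
Unset Strict Implicit.
Unset Printing Implicit Defensive.

Import Order.TTheory GRing.Theory Num.Theory.
Import numFieldNormedType.Exports.

Local Open Scope ring_scope.

Section DotProduct.
Variable R : realType.
Implicit Types (n m : nat) (a : R).

Lemma dotvE n (u v : 'cV[R]_n) : dotv u v = \sum_i u i 0 * v i 0.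
Proof. by rewrite /dotv mxE; apply: eq_bigr => i _; rewrite mxE. Qed.

Lemma dotvC n (u v : 'cV[R]_n) : dotv u v = dotv v u.
Proof. by rewrite !dotvE; apply: eq_bigr => i _; rewrite mulrC. Qed.

Lemma dotvDr n (u v w : 'cV[R]_n) : dotv u (v + w) = dotv u v + dotv u w.
Proof. by rewrite /dotv mulmxDr mxE. Qed.

Lemma dotvDl n (u v w : 'cV[R]_n) : dotv (u + v) w = dotv u w + dotv v w.
Proof. by rewrite dotvC dotvDr !(dotvC w). Qed.

Lemma dotvZr n a (u v : 'cV[R]_n) : dotv u (a *: v) = a * dotv u v.
Proof. by rewrite /dotv -scalemxAr mxE. Qed.

Lemma dotvZl n a (u v : 'cV[R]_n) : dotv (a *: u) v = a * dotv u v.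
Proof. by rewrite dotvC dotvZr dotvC. Qed.

Lemma dotvNr n (u v : 'cV[R]_n) : dotv u (- v) = - dotv u v.
Proof. by rewrite -scaleN1r dotvZr mulN1r. Qed.

Lemma dotvNl n (u v : 'cV[R]_n) : dotv (- u) v = - dotv u v.
Proof. by rewrite dotvC dotvNr dotvC. Qed.

Lemma dotv0 n (u : 'cV[R]_n) : dotv u 0 = 0.
Proof. by rewrite /dotv mulmx0 mxE. Qed.

Lemma dot0v n (u : 'cV[R]_n) : dotv 0 u = 0.
Proof. by rewrite dotvC dotv0. Qed.

Lemma dotv_sumr n (I : finType) (u : 'cV[R]_n) (F : I -> 'cV[R]_n) :
  dotv u (\sum_i F i) = \sum_i dotv u (F i).
Proof. by rewrite /dotv mulmx_sumr summxE. Qed.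

Lemma dotv_tr n m (A : 'M[R]_(n, m)) u v :
  dotv u (A^T *m v) = dotv (A *m u) v.
Proof. by rewrite /dotv trmx_mul mulmxA. Qed.

Lemma dotv_col_mx n m (u1 v1 : 'cV[R]_n) (u2 v2 : 'cV[R]_m) :
  dotv (col_mx u1 u2) (col_mx v1 v2) = dotv u1 v1 + dotv u2 v2.
Proof. by rewrite /dotv tr_col_mx mul_row_col mxE. Qed.

Lemma dotv_ge0 n (u : 'cV[R]_n) : 0 <= dotv u u.
Proof. by rewrite dotvE; apply: sumr_ge0 => i _; rewrite -expr2 sqr_ge0. Qed.

Lemma dotv_eq0 n (u : 'cV[R]_n) : dotv u u = 0 -> u = 0.
Proof.
rewrite dotvE => /eqP; rewrite psumr_eq0; last first.
  by move=> i _; rewrite -expr2 sqr_ge0.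
move=> /allP u0; apply/colP => i; rewrite mxE; apply/eqP.
by have := u0 i (mem_index_enum i); rewrite /= -expr2 sqrf_eq0.
Qed.

End DotProduct.

Section Coercive.
Variable R : realType.

(** The matrix inequality [B >= eps I] read through the quadratic form only; symmetry is kept
    apart. *)
Definition coercive n (B : 'M[R]_n) (eps : R) : Prop :=
  forall v, eps * dotv v v <= dotv v (B *m v).

(** A row vector [v] with [v B = 0] makes the form vanish at [v^T], so the left kernel of [B] is
    trivial. *)
Lemma anisotropic_unitmx n (B : 'M[R]_n) :
  (forall v, dotv v (B *m v) = 0 -> v = 0) -> B \in unitmx.
Proof.
move=> B_inj; rewrite -row_free_unit; apply: inj_row_free => v vB0.
apply: trmx_inj; rewrite trmx0; apply: B_inj.
by rewrite /dotv trmxK mulmxA vB0 mul0mx mxE.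
Qed.

Lemma coercive_anisotropic n (B : 'M[R]_n) eps : 0 < eps -> coercive B eps ->
  forall v, dotv v (B *m v) <= 0 -> v = 0.
Proof.
move=> eps0 Bc v Bv0; apply: dotv_eq0; apply/eqP.
rewrite eq_le dotv_ge0 andbT -(pmulr_rle0 _ eps0).
exact: le_trans (Bc v) Bv0.
Qed.

Lemma coercive_unitmx n (B : 'M[R]_n) eps :
  0 < eps -> coercive B eps -> B \in unitmx.
Proof.
move=> eps0 Bc; apply: anisotropic_unitmx => v Bv0.
by apply: (coercive_anisotropic eps0 Bc); rewrite Bv0.
Qed.

(** The Gram term adds [|J v|^2 >= 0], so the shift alone gives the bound, whatever the rank of
    [J]. *)
Lemma coercive_gram n q (J : 'M[R]_(q, n)) eps :
  coercive (J^T *m J + eps%:M) eps.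
Proof.
move=> v; rewrite mulmxDl dotvDr -mulmxA dotv_tr mul_scalar_mx dotvZr.
by rewrite lerDr dotv_ge0.
Qed.

End Coercive.

Section SchurComplement.
Variables (R : realType) (n m : nat).
Implicit Types (B : 'M[R]_(n + m)) (g w : 'cV[R]_(n + m)).

Lemma mul_selx w : selx R n m *m w = usubmx w.
Proof. by rewrite -[w in LHS]vsubmxK mul_row_col mul1mx mul0mx addr0. Qed.

Lemma mul_tr_selx (u : 'cV[R]_n) : (selx R n m)^T *m u = col_mx u 0.
Proof. by rewrite tr_row_mx trmx1 trmx0 mul_col_mx mul1mx mul0mx. Qed.

Lemma mulmx_col_mx B (x : 'cV[R]_n) (y : 'cV[R]_m) :
  B *m col_mx x y = col_mx (ulsubmx B *m x + ursubmx B *m y)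
                           (dlsubmx B *m x + drsubmx B *m y).
Proof. by rewrite -{1}[B]submxK mul_block_col. Qed.

Lemma coercive_drsubmx B eps : coercive B eps -> coercive (drsubmx B) eps.
Proof.
move=> Bc y; have := Bc (col_mx 0 y).
by rewrite mulmx_col_mx !mulmx0 !add0r !dotv_col_mx !dot0v !add0r.
Qed.

(** Subtracting [B^xy (B^yy)^-1] times the second block of [B w] from the first cancels the hidden
    part of [w]. This turns an equation for the full vector into one for [x] alone. *)
Lemma condB_mul B w : drsubmx B \in unitmx ->
  condB B *m usubmx w = condg B (B *m w).
Proof.
move=> Uyy; rewrite -[w]vsubmxK; move: (usubmx w) (dsubmx w) => x y.
rewrite /condB /condg mulmx_col_mx !col_mxKu col_mxKd mulmxDr !mulmxA.
by rewrite mulmxKV // mulmxBl opprD addrACA subrr addr0.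
Qed.

Lemma condgB B g h : condg B (g - h) = condg B g - condg B h.
Proof. by rewrite /condg !linearB /= addrACA. Qed.

(** Multipliers enter the full system as [A^T lam = (lam, 0)], so condensation returns them
    unchanged. *)
Lemma condg_col0 B (u : 'cV[R]_n) : condg B (col_mx u 0) = u.
Proof. by rewrite /condg col_mxKu col_mxKd mulmx0 subr0. Qed.

Lemma condB_form B (x : 'cV[R]_n) : drsubmx B \in unitmx ->
  let w := col_mx x (- (invmx (drsubmx B) *m dlsubmx B *m x)) in
  B *m w = col_mx (condB B *m x) 0.
Proof.
move=> Uyy /=; rewrite mulmx_col_mx !mulmxN !mulmxA.
by rewrite mulmxV // mul1mx subrr /condB mulmxBl.
Qed.

(** Since [|(x, y)|^2 >= |x|^2], the constant [eps] survives the elimination without loss. *)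
Lemma coercive_condB B eps :
  0 < eps -> coercive B eps -> coercive (condB B) eps.
Proof.
move=> eps0 Bc x; have Uyy := coercive_unitmx eps0 (coercive_drsubmx Bc).
have := Bc (col_mx x (- (invmx (drsubmx B) *m dlsubmx B *m x))).
rewrite condB_form // !dotv_col_mx dotv0 addr0; apply: le_trans.
by rewrite ler_pM2l // lerDl dotv_ge0.
Qed.

Lemma trmx_condB B : B^T = B -> (condB B)^T = condB B.
Proof.
move=> Bsym; rewrite /condB linearB /= !trmx_mul trmx_inv.
by rewrite trmx_ulsub trmx_ursub trmx_dlsub trmx_drsub Bsym mulmxA.
Qed.

End SchurComplement.

Section QuadraticProgramTheory.
Variables (R : realType) (Reg : finType) (nx : Reg -> nat) (p : nat).
Variable E : forall l, 'M[R]_(nx l, p).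
Variables (Bb : forall l, 'M[R]_(nx l)) (gb xk : forall l, 'cV[R]_(nx l)).

(** The linear part has no convexity gap, and the gap of half the form is exactly [t (1 - t) / 2]
    times the form at [x - x']; hence the modulus is [mu] itself. *)
Lemma coercive_qp_strongly_convex mu :
  0 < mu -> (forall l, coercive (Bb l) mu) -> qp_strongly_convex Bb gb xk.
Proof.
move=> mu0 Bc; exists mu => // x x' t /andP[t0 t1].
rewrite /qp_obj !mulr_sumr -!big_split -sumrN -!big_split /=.
apply: ler_sum => l _; have := Bc l (x l - x' l).
rewrite !(mulmxDr, mulmxN, dotvDl, dotvDr, dotvNl, dotvNr).
rewrite -!scalemxAr !(dotvZl, dotvZr) => Bcl.
have s0 : 0 <= t * (1 - t) by rewrite mulr_ge0 // subr_ge0.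
have := ler_wpM2l s0 Bcl; lra.
Qed.

Lemma qp_kkt_minimizer x z lam :
  (forall l, (Bb l)^T = Bb l) -> (forall l v, 0 <= dotv v (Bb l *m v)) ->
  qp_kkt E Bb gb xk x z lam -> qp_minimizer E Bb gb xk x z.
Proof.
move=> Bsym Bpos [stat feas dual]; split=> // x' z' feas'.
(* A feasible displacement is [E_l (z' - z)] in each region, hence orthogonal to the stacked
   multiplier by dual feasibility. *)
have lam0 : \sum_l dotv (x' l - x l) (lam l) = 0.
  transitivity (dotv (z' - z) (\sum_l (E l)^T *m lam l)).
    rewrite dotv_sumr; apply: eq_bigr => l _.
    by rewrite feas feas' -mulmxBr dotv_tr.
  by rewrite dual dotv0.
(* Adding this zero sum leaves one inequality per region: as [lam l] is minus the gradient at [x l],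
   the two sides differ by half the form at [x' l - x l]. *)
rewrite /qp_obj -[leRHS]addr0 -[X in _ + X]lam0 -big_split /=.
apply: ler_sum => l _.
have : lam l = Bb l *m xk l - gb l - Bb l *m x l.
  have /eqP := stat l; rewrite addrC addr_eq0 => /eqP ->.
  by rewrite mulmxBr opprD opprB addrAC.
move=> ->; have := Bpos l (x' l - x l).
have Bxx' : dotv (x l) (Bb l *m x' l) = dotv (x' l) (Bb l *m x l).
  by rewrite -{1}Bsym dotv_tr dotvC.
rewrite !(mulmxDr, mulmxN, dotvDl, dotvDr, dotvNl, dotvNr) Bxx'.
rewrite (dotvC (gb l)) (dotvC (gb l)) !(dotvC (Bb l *m xk l)); lra.
Qed.

(** A row with a 1 in column [j] is the unit row [e_j], so the matching entry of [E_l z] is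
    [z_j]. *)
Lemma incidence_inj (z : 'cV[R]_p) :
  incidence E -> (forall l, E l *m z = 0) -> z = 0.
Proof.
move=> [E01 Euniq Ecov] Ez0; apply/colP => j.
have [l [i Eij]] := Ecov j; have [j0 [Eij0 j0P]] := Euniq l i.
have := Ez0 l => /colP/(_ i); rewrite !mxE (bigD1 j) //= Eij mul1r.
rewrite big1 ?addr0 // => k kj; have [->|Eik] := E01 l i k; first by rewrite mul0r.
by move: kj; rewrite -(j0P _ Eik) (j0P _ Eij) eqxx.
Qed.

(** The form at [z] is a sum of nonnegative forms at the [E_l z]; if it vanishes, every [E_l z] is
    0, and so is [z]. *)
Lemma coord_unitmx mu : incidence E -> 0 < mu ->
  (forall l, coercive (Bb l) mu) ->
  \sum_l (E l)^T *m Bb l *m E l \in unitmx.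
Proof.
move=> hE mu0 Bc; apply: anisotropic_unitmx => z.
rewrite mulmx_suml dotv_sumr => /eqP.
under eq_bigr do rewrite -!mulmxA dotv_tr.
rewrite psumr_eq0 => [/allP Mz0|l _]; last first.
  by apply: le_trans (Bc l _); rewrite mulr_ge0 ?dotv_ge0 // ltW.
apply: incidence_inj => // l; apply: (coercive_anisotropic mu0 (Bc l)).
by rewrite (eqP (Mz0 l (mem_index_enum l))).
Qed.

End QuadraticProgramTheory.

Theorem proposition1 (R : realType) (Reg : finType)
    (nx ny nr : Reg -> nat) (p : nat)
    (E : forall l, 'M[R]_(nx l, p))
    (r : forall l, 'cV[R]_(nx l + ny l) -> 'cV[R]_(nr l))
    (eps : R) (chi : forall l, 'cV[R]_(nx l + ny l))
    (hE : incidence E)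
    (hr : forall l, smooth (@r l))
    (heps : 0 < eps) :
  [/\ hdsqp_well_defined E r eps chi,
      qp_strongly_convex (Bbark r eps chi) (gbark r eps chi) (xk chi),
      qp_minimizer E (Bbark r eps chi) (gbark r eps chi) (xk chi)
        (x_next E r eps chi) (zbar E r eps chi)
    & qp_kkt E (Bbark r eps chi) (gbark r eps chi) (xk chi)
        (x_next E r eps chi) (zbar E r eps chi) (lam_next E r eps chi)].
Proof.
have Bc l : coercive (Bk r eps chi l) eps by exact: coercive_gram.
have Bbc l : coercive (Bbark r eps chi l) eps by exact: coercive_condB.
have UB l := coercive_unitmx heps (Bc l).
have Uyy l := coercive_unitmx heps (coercive_drsubmx (Bc l)).
have Ubb l := coercive_unitmx heps (Bbc l).
have UM : coordM E r eps chi \in unitmx by exact: coord_unitmx Bbc.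
have Bxbar l : Bbark r eps chi l *m xbar r eps chi l
    = Bbark r eps chi l *m xk chi l - gbark r eps chi l.
  by rewrite mulKVmx.
have Bxnext l : Bbark r eps chi l *m x_next E r eps chi l
    = Bbark r eps chi l *m xk chi l - gbark r eps chi l - lam_next E r eps chi l.
  (* Condense the full update equation [B chi_next = B chi - g - A^T lam]. *)
  rewrite /x_next /xk !mul_selx !condB_mul // mulKVmx // mul_tr_selx.
  by rewrite !condgB condg_col0.
have kkt : qp_kkt E (Bbark r eps chi) (gbark r eps chi) (xk chi)
    (x_next E r eps chi) (zbar E r eps chi) (lam_next E r eps chi).
  split=> [l|l|].
  - rewrite mulmxBr Bxnext [X in X + _ + _]addrAC [X in X + _ + _ + _]addrAC.
    by rewrite subrr add0r -opprD -addrA addNr.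
  (* Feasibility may be checked after multiplying by the invertible [Bbar]. *)
  - apply: (can_inj (mulKmx (Ubb l))).
    by rewrite Bxnext -Bxbar /lam_next mulmxBr subKr.
  (* The linear system solved by [zbar] makes the two sums of the dual residual cancel. *)
  - have Mzbar : coordM E r eps chi *m zbar E r eps chi
        = \sum_l (E l)^T *m Bbark r eps chi l *m xbar r eps chi l.
      by rewrite mulKVmx.
    under eq_bigr do rewrite mulmxA mulmxBr (mulmxA _ (E _)).
    by rewrite sumrB -mulmx_suml -Mzbar subrr.
split=> //.
- exact: coercive_qp_strongly_convex heps Bbc.
- apply: qp_kkt_minimizer kkt => l => [|v].
    apply: trmx_condB.
    by rewrite /Bk linearD /= trmx_mul trmxK tr_scalar_mx.
  by apply: le_trans (Bbc l v); rewrite mulr_ge0 ?dotv_ge0 // ltW.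
Qed.
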